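(* Let $X$ be a Banach lattice and let $S,T\colon X\to X$ be positive operators such that $0\le S\le T\le Id_X$. If $T$ is weakly demi Dunford-Pettis, then $S$ is weakly demi Dunford-Pettis.
   Context: Operators are bounded and linear, and $Id_X$ is the identity operator of $X$. An operator $T$ on a Banach lattice $X$ is positive if $T(x)\ge 0$ whenever $x\ge 0$; for operators $S,T$ on $X$, $S\le T$ means that $(T-S)(x)\ge 0$ for every $x\ge 0$ in $X$. $X'$ and $X''$ denote the topological dual and bidual of $X$; weak convergence in $X$ is convergence in $\sigma(X,X')$ and weak convergence in $X'$ is convergence in $\sigma(X',X'')$. An operator $T\colon X\to X$ is weakly demi Dunford-Pettis if for all sequences $(x_j)_{j=1}^{\infty}$ in $X$ and $(f_j)_{j=1}^{\infty}$ in $X'$ with $x_j\to 0$ weakly in $X$, $f_j\to 0$ weakly in $X'$ and $\|x_j-T(x_j)\|\to 0$, one has $|f_j(x_j)|\to 0$ as $j\to\infty$. *)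

(* Defs.v *)
From HB Require Import structures.
From mathcomp Require Import all_boot all_order all_algebra.
From mathcomp Require Import all_classical all_reals.
From mathcomp Require Import topology normedtype sequences.

Set Implicit Arguments.
Unset Strict Implicit.
Unset Printing Implicit Defensive.

Import Order.TTheory GRing.Theory Num.Theory.
Import numFieldNormedType.Exports.

Local Open Scope classical_set_scope.
Local Open Scope ring_scope.

(* The order is part of the mixin, and becomes an instance of the lattice
   structures of the library only below: declaring the structure as a join of
   CompleteNormedModule and Order.Lattice is rejected by Hierarchy Builder,
   because the library lacks intermediate joins below RealDomain. *)
HB.mixin Record CompleteNormedModule_isBanachLattice (R : realType) X
    of CompleteNormedModule R X := {
  bl_le : rel X;
  bl_join : X -> X -> X;
  bl_meet : X -> X -> X;
  bl_le_refl : reflexive bl_le;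
  bl_le_anti : antisymmetric bl_le;
  bl_le_trans : transitive bl_le;
  bl_leUx : forall x y z,
    bl_le (bl_join x y) z = bl_le x z && bl_le y z;
  bl_lexI : forall x y z,
    bl_le x (bl_meet y z) = bl_le x y && bl_le x z;
  bl_leD2r : forall x y z, bl_le x y -> bl_le (x + z) (y + z);
  bl_scaler_ge0 : forall (a : R) x, 0 <= a -> bl_le 0 x -> bl_le 0 (a *: x);
  bl_ler_norm : forall x y,
    bl_le (bl_join x (- x)) (bl_join y (- y)) -> `|x| <= `|y|
}.

#[short(type="banachLatticeType")]
HB.structure Definition BanachLattice (R : realType) :=
  {X of CompleteNormedModule R X & CompleteNormedModule_isBanachLattice R X}.

Section BanachLatticeOrder.
Context {R : realType} (X : banachLatticeType R).

HB.instance Definition _ := Order.Le_isPOrder.Build ring_display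
  (BanachLattice.sort X) (@bl_le_refl R X) (@bl_le_anti R X)
  (@bl_le_trans R X).
HB.instance Definition _ := Order.POrder_isJoinSemilattice.Build ring_display
  (BanachLattice.sort X) (@bl_leUx R X).
HB.instance Definition _ := Order.POrder_isMeetSemilattice.Build ring_display
  (BanachLattice.sort X) (@bl_lexI R X).

Lemma lattice_leD2r (x y z : X) : x <= y -> x + z <= y + z.
Proof. exact: bl_leD2r. Qed.

Lemma lattice_scaler_ge0 (a : R) (x : X) : 0 <= a -> 0 <= x -> 0 <= a *: x.
Proof. exact: bl_scaler_ge0. Qed.

Definition modulus (x : X) : X := Order.join x (- x).

Lemma lattice_ler_norm (x y : X) : modulus x <= modulus y -> `|x| <= `|y|.
Proof. exact: bl_ler_norm. Qed.

End BanachLatticeOrder.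

Section Dual.
Context {R : realType} (V : normedModType R).

Definition functionals : {pred V -> R^o} :=
  mem [set f : V -> R^o | linear f /\ continuous f].

(* The topological dual V', normed below by the operator norm; the bidual is
   dual (dual V). *)
Record dual := Dual {
  dual_fun :> V -> R^o;
  dual_funP : dual_fun \in functionals }.

HB.instance Definition _ := [isSub for dual_fun].
HB.instance Definition _ := [Choice of dual by <:].

Lemma functionals_submod : submod_closed functionals.
Proof.
split.
  rewrite inE /=; split; last by move=> x; exact: cst_continuous.
  by move=> a x y /=; rewrite scaler0 addr0.
move=> a f g; rewrite !inE /= => -[lf cf] [lg cg]; split.
  move=> b x y; rewrite !fctE /= lf lg !scalerDr !scalerA mulrC.
  by rewrite addrACA.
move=> x; apply: cvgD; last exact: cg.
by apply: cvgZl_tmp; exact: cf.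
Qed.

HB.instance Definition _ :=
  GRing.isSubmodClosed.Build R (V -> R^o) functionals functionals_submod.

HB.instance Definition _ := [SubChoice_isSubLmodule of dual by <:].

Lemma dual_linear (f : dual) : linear f.
Proof. by have := dual_funP f; rewrite inE => -[]. Qed.

Lemma dual_continuous (f : dual) : continuous f.
Proof. by have := dual_funP f; rewrite inE => -[]. Qed.

HB.instance Definition _ (f : dual) :=
  GRing.isLinear.Build R V R^o *:%R f (@dual_linear f).

Definition dual_norm (f : dual) : R :=
  sup [set `|f x| | x in [set x : V | `|x| <= 1]].

Lemma dual_norm_has_sup (f : dual) :
  has_sup [set `|f x| | x in [set x : V | `|x| <= 1]].
Proof.
split; first by exists `|f 0|, 0 => //=; rewrite normr0 ler01.
have /bounded_funP/(_ 1)[M fM] : bounded_near f (nbhs (0 : V)).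
  exact/continuous_linear_bounded/dual_continuous.
by exists M => _ [x /= x1 <-]; exact: fM.
Qed.

Lemma dual_norm_le1 (f : dual) (x : V) : `|x| <= 1 -> `|f x| <= dual_norm f.
Proof.
by move=> x1; apply: ub_le_sup; [case: (dual_norm_has_sup f)|exists x].
Qed.

Lemma dual_norm_le (f : dual) (M : R) :
  (forall x, `|x| <= 1 -> `|f x| <= M) -> dual_norm f <= M.
Proof.
move=> fM; apply: ge_sup; first by case: (dual_norm_has_sup f).
by move=> _ [x /= x1 <-]; exact: fM.
Qed.

Lemma ler_dual_normD (f g : dual) :
  dual_norm (f + g) <= dual_norm f + dual_norm g.
Proof.
apply: dual_norm_le => x x1.
by rewrite (le_trans (ler_normD _ _))// lerD// dual_norm_le1.
Qed.

Lemma ler_dual_normZ (a : R) (f : dual) :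
  dual_norm (a *: f) <= `|a| * dual_norm f.
Proof.
apply: dual_norm_le => x x1.
by rewrite [X in X <= _]normrM ler_wpM2l// dual_norm_le1.
Qed.

Lemma dual_normZ (a : R) (f : dual) :
  dual_norm (a *: f) = `|a| * dual_norm f.
Proof.
apply/eqP; rewrite eq_le ler_dual_normZ/=.
have [->|a0] := eqVneq a 0.
  rewrite normr0 mul0r.
  by rewrite (le_trans _ (@dual_norm_le1 _ 0 _)) ?normr0 ?ler01.
rewrite -ler_pdivlMl ?normr_gt0// -normfV.
by rewrite -[X in dual_norm X <= _](scalerK a0) ler_dual_normZ.
Qed.

Lemma dual_norm0_eq0 (f : dual) : dual_norm f = 0 -> f = 0.
Proof.
move=> f0; apply/val_inj/funext => x /=.
have [->|x0] := eqVneq x 0; first by rewrite linear0.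
have := @dual_norm_le1 f (`|x|^-1 *: x).
rewrite normrZ normfV normr_id mulVf ?normr_eq0// lexx => /(_ isT).
rewrite f0 linearZ normr_le0 scaler_eq0 invr_eq0 normr_eq0 (negbTE x0)/=.
by move=> /eqP.
Qed.

HB.instance Definition _ := @Lmodule_isNormed.Build R dual dual_norm
  ler_dual_normD dual_normZ dual_norm0_eq0.

(* V with the topology sigma(V, V'): the coarsest one for which every f : dual
   is continuous. *)
Definition weak : Type :=
  initial_topology (fun (v : V) => (fun f : dual => f v) : {ptws dual -> R^o}).

HB.instance Definition _ := Topological.on weak.

Definition weakly_cvg (x : nat -> V) (l : V) :=
  (x : nat -> weak) @ \oo --> (l : weak).

Lemma weakly_cvgP (x : nat -> V) (l : V) :
  weakly_cvg x l <-> forall f : dual, f (x n) @[n --> \oo] --> f l.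
Proof.
pose ev (v : V) : {ptws dual -> R^o} := fun f => f v.
have xE : weakly_cvg x l <-> {ptws, (ev \o x) @ \oo --> ev l}.
  split=> [xl|evxl].
    have evc : continuous (ev : weak -> {ptws dual -> R^o}).
      exact: initial_continuous.
    by apply: cvg_trans (evc l) => A /= /xl.
  move=> A /= [_ [[B oB <-] Bl BA]].
  have evxB : \forall n \near \oo, B (ev (x n)).
    by apply: evxl; exact: open_nbhs_nbhs.
  suff : \forall n \near \oo, A (x n) by [].
  by apply: filterS evxB => n; exact: BA.
by rewrite xE pointwise_cvgP.
Qed.

End Dual.

Section Operators.
Context {R : realType} {X : banachLatticeType R}.
Implicit Types S T : X -> X.

Definition positive_op T := forall x : X, 0 <= x -> 0 <= T x.

Definition op_le S T := forall x : X, 0 <= x -> 0 <= (T \- S) x.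

Definition weakly_demi_Dunford_Pettis T :=
  forall (x : nat -> X) (f : nat -> dual X),
    weakly_cvg x 0 -> weakly_cvg f 0 ->
    `|x j - T (x j)| @[j --> \oo] --> (0 : R) ->
    `|f j (x j)| @[j --> \oo] --> (0 : R).

End Operators.

(* Main.v *)
Require Import Defs.
From HB Require Import structures.
From mathcomp Require Import all_boot all_order all_algebra.
From mathcomp Require Import all_classical all_reals.
From mathcomp Require Import topology normedtype sequences.

Import Order.TTheory GRing.Theory Num.Theory.
Import numFieldNormedType.Exports.

Local Open Scope ring_scope.

(** Put [A = Id - S] and [B = Id - T], so that [0 <= B <= A <= Id].  The point
    is that [||B x|| <= ||A x||] for every vector [x], not only for positive ones:
    a sequence with [x_j - S x_j --> 0] then also has [x_j - T x_j --> 0], and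
    the hypothesis on [T] applies to the same sequences [x_j] and [f_j].

    For a general pair of positive operators, domination on the positive cone
    gives only [|B x| <= B |x| <= A |x|], where [A |x|] may be much larger than
    [|A x|].  But [A <= Id] makes [A] preserve disjointness: [A] sends the
    disjoint vectors [x^+] and [x^-] to vectors below them, which are therefore
    disjoint too, and for disjoint positive vectors [u] and [v] no cancellation
    occurs in [u - v], that is [u + v <= |u - v|].  Hence
      [|B x| <= B x^+ + B x^- <= A x^+ + A x^- <= |A x|],
    and the lattice norm is monotone in the modulus. *)

Section BanachLatticeTheory.
Context {R : realType} {X : banachLatticeType R}.
Implicit Types (x u v : X) (A B : {linear X -> X}).

Lemma lattice_subr_ge0 u v : (0 <= v - u) = (u <= v).
Proof.
apply/idP/idP => [/(lattice_leD2r u)|/(lattice_leD2r (- u))].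
  by rewrite add0r subrK.
by rewrite subrr.
Qed.

Lemma lattice_leD (x1 x2 y1 y2 : X) :
  x1 <= y1 -> x2 <= y2 -> x1 + x2 <= y1 + y2.
Proof.
move=> /(lattice_leD2r x2) le1 /(lattice_leD2r y1).
by rewrite ![_ + y1]addrC; exact: le_trans.
Qed.

Lemma modulusB_le u v : 0 <= u -> 0 <= v -> modulus (u - v) <= u + v.
Proof.
move=> u0 v0.
have oppr_le (w : X) : 0 <= w -> - w <= w.
  by move=> w0; apply: (le_trans _ w0); rewrite -lattice_subr_ge0 sub0r opprK.
rewrite /modulus leUx opprB [v - u]addrC.
by rewrite !lattice_leD ?oppr_le.
Qed.

(** With [w = |u - v|], both [u] and [v] dominate [(u + v - w) / 2], because
    [v - u <= w] and [u - v <= w]; so does their infimum. *)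
Lemma disjoint_modulusB_ge u v :
  Order.meet u v <= 0 -> u + v <= modulus (u - v).
Proof.
set w := modulus _ => uv0.
have half_le (a b : X) : b - a <= w -> 2^-1 *: (a + b - w) <= a.
  move=> abw; rewrite -lattice_subr_ge0.
  suff -> : a - 2^-1 *: (a + b - w) = 2^-1 *: (w - (b - a)).
    by apply: lattice_scaler_ge0; rewrite ?invr_ge0 ?ler0n ?lattice_subr_ge0.
  have {1}-> : a = 2^-1 *: (a + a).
    by rewrite -mulr2n -(scaler_nat 2 a) scalerA mulVf ?scale1r// pnatr_eq0.
  rewrite -scalerBr; congr (_ *: _).
  by rewrite !opprB addrCA opprD addrACA subrr add0r.
have half_le0 : 2^-1 *: (u + v - w) <= 0.
  apply: le_trans uv0; rewrite lexI half_le.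
    by rewrite [u + v]addrC half_le// leUl.
  by rewrite -opprB leUr.
rewrite -lattice_subr_ge0.
have -> : w - (u + v) = 2 *: (0 - 2^-1 *: (u + v - w)).
  by rewrite sub0r scalerN scalerA mulfV ?pnatr_eq0// scale1r opprB.
by apply: lattice_scaler_ge0; rewrite ?ler0n// lattice_subr_ge0.
Qed.

Lemma pos_neg_part_decomposition x :
  exists u v, [/\ 0 <= u, 0 <= v, Order.meet u v <= 0 & x = u - v].
Proof.
pose u := Order.join x 0.
exists u, (u - x); split; first exact: leUr.
- by rewrite lattice_subr_ge0 leUl.
- set z := Order.meet _ _.
  (* as [z] is below [u] and [u - x], the vector [u - z] is above [0] and [x],
     hence above their supremum [u] *)
  suff : u <= u - z.
    by rewrite -lattice_subr_ge0 addrAC subrr lattice_subr_ge0.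
  rewrite {1}/u leUx lattice_subr_ge0 leIl andbT.
  by rewrite -lattice_subr_ge0 addrAC lattice_subr_ge0 leIr.
- by rewrite opprB addrCA subrr addr0.
Qed.

(** Domination by the identity is what removes the usual restriction to
    positive vectors: it makes the images under [A] of the positive and negative
    parts of [x] disjoint, so that nothing cancels in [A x]. *)
Lemma norm_le_of_op_le_id A B :
  positive_op B -> op_le B A -> op_le A idfun -> forall x, `|B x| <= `|A x|.
Proof.
move=> B0 leBA leA1 x; apply: lattice_ler_norm.
have leBAx (y : X) : 0 <= y -> B y <= A y.
  by move=> /leBA; rewrite /= lattice_subr_ge0.
have leA1x (y : X) : 0 <= y -> A y <= y.
  by move=> /leA1; rewrite /= lattice_subr_ge0.
have [u [v [u0 v0 uv0 ->]]] := pos_neg_part_decomposition x.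
rewrite !linearB.
apply: (le_trans (modulusB_le _ _ (B0 _ u0) (B0 _ v0))).
apply: (le_trans (lattice_leD _ _ _ _ (leBAx _ u0) (leBAx _ v0))).
apply: disjoint_modulusB_ge; apply: le_trans uv0.
by rewrite leI2 ?leA1x.
Qed.

End BanachLatticeTheory.

Theorem theorem3p1 (R : realType) (X : banachLatticeType R)
    (S T : {linear X -> X})
    (bounded_S : bounded_fun_norm S) (bounded_T : bounded_fun_norm T)
    (pos_S : positive_op S) (pos_T : positive_op T)
    (le_0S : op_le \0 S) (le_ST : op_le S T) (le_TId : op_le T idfun) :
  weakly_demi_Dunford_Pettis T -> weakly_demi_Dunford_Pettis S.
Proof.
move=> wT x f x0 f0 xS0; apply: wT => //.
pose A : {linear X -> X} := idfun \- S.
pose B : {linear X -> X} := idfun \- T.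
have leBA : op_le B A.
  move=> y /le_ST STy.
  by rewrite /A /B /= opprB addrC addrA subrK.
have leA1 : op_le A idfun.
  by move=> y /pos_S Sy0; rewrite /A /= opprB addrCA subrr addr0.
apply: (squeeze_cvgr _ (cvg_cst 0) xS0).
by apply: nearW => j; rewrite normr_ge0 (@norm_le_of_op_le_id _ _ A B).
Qed.
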